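(* The projective profinite groups are precisely the closed subgroups of free profinite monoids: a profinite group $G$ is projective if and only if $G$ is isomorphic, as a topological group, to a closed subgroup of some free profinite monoid.
   Context: A profinite monoid is a topological monoid that is a projective limit of finite discrete monoids. For a topological space $X$, the free profinite monoid on $X$ is the profinite monoid $F$ equipped with a continuous map $X\to F$ such that every continuous map from $X$ to a profinite monoid $M$ extends uniquely to a continuous monoid homomorphism $F\to M$. A closed subgroup of a profinite monoid is a topologically closed subsemigroup that is a group under the induced multiplication (its identity is an idempotent, not necessarily the identity of the monoid); it is given the induced topology. A profinite group $G$ is projective if for every finite group $A$, every epimorphism of finite groups $\alpha:A\to B$, and every continuous epimorphism $\varphi:G\to B$ ($B$ discrete), there is a continuous homomorphism $\widetilde\varphi:G\to A$ with $\alpha\circ\widetilde\varphi=\varphi$. *)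

(* Defs.v *)
From HB Require Import structures.
From mathcomp Require Import all_boot all_order all_fingroup.
From mathcomp Require Import all_classical topology.

Set Implicit Arguments.
Unset Strict Implicit.
Unset Printing Implicit Defensive.

Local Open Scope classical_set_scope.
Local Open Scope group_scope.

HB.mixin Record isTopologicalMonoid M & Topological M & monoid.Monoid M := {
  mulg_continuous : continuous (fun p : M * M => p.1 * p.2)
}.

#[short(type="topologicalMonoidType")]
HB.structure Definition TopologicalMonoid :=
  {M of Topological M & monoid.Monoid M & isTopologicalMonoid M}.

HB.mixin Record isTopologicalGroup G & Topological G & monoid.Group G := {
  invg_continuous : continuous (fun x : G => x^-1)
}.

#[short(type="topologicalGroupType")]
HB.structure Definition TopologicalGroup :=
  {G of TopologicalMonoid G & monoid.Group G & isTopologicalGroup G}.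

Definition homeomorphic_bijection (X Y : topologicalType) (f : X -> Y) : Prop :=
  continuous f /\
  exists g : Y -> X, [/\ continuous g, cancel f g & cancel g f].

(* Inverse systems of monoids over a directed poset. Every monoid homomorphism
   between groups is a group homomorphism, so the same definitions serve for
   groups through the coercion from groupType to monoidType. *)
Definition inverse_system (d : Order.disp_t) (I : porderType d)
    (S : I -> monoidType)
    (phi : forall i j : I, (i <= j)%O -> S j -> S i) : Prop :=
  [/\ inhabited I,
      forall i j : I, exists k : I, (i <= k)%O /\ (j <= k)%O,
      forall (i j : I) (ij : (i <= j)%O), monoid_morphism (phi i j ij),
      forall (i : I) (ii : (i <= i)%O) (x : S i), phi i i ii x = x &
      forall (i j k : I) (ij : (i <= j)%O) (jk : (j <= k)%O) (ik : (i <= k)%O)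
        (x : S k), phi i j ij (phi j k jk x) = phi i k ik x].

(* As a type, [threads phi] has the topology induced by the product of the
   discrete spaces [S i]. *)
Definition threads (d : Order.disp_t) (I : porderType d) (S : I -> monoidType)
    (phi : forall i j : I, (i <= j)%O -> S j -> S i) :
    set (prod_topology (fun i : I => discrete_topology (S i))) :=
  [set x | forall (i j : I) (ij : (i <= j)%O), phi i j ij (x j) = x i].

(* The operations of the limit are componentwise, so an isomorphism of [M] onto
   it is a homeomorphism whose components are monoid homomorphisms. *)
Definition is_projective_limit (d : Order.disp_t) (I : porderType d)
    (S : I -> monoidType)
    (phi : forall i j : I, (i <= j)%O -> S j -> S i)
    (M : topologicalMonoidType) : Prop :=
  exists f : M -> threads phi,
    homeomorphic_bijection f /\
    forall i : I, monoid_morphism (fun x : M => (set_val (f x) i : S i)).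

Definition profinite_monoid (M : topologicalMonoidType) : Prop :=
  exists (d : Order.disp_t) (I : porderType d) (S : I -> monoidType)
    (phi : forall i j : I, (i <= j)%O -> S j -> S i),
    [/\ forall i : I, finite_set [set: S i],
        inverse_system phi & is_projective_limit phi M].

Definition profinite_group (G : topologicalGroupType) : Prop :=
  exists (d : Order.disp_t) (I : porderType d) (S : I -> groupType)
    (phi : forall i j : I, (i <= j)%O -> S j -> S i),
    [/\ forall i : I, finite_set [set: S i],
        inverse_system phi & is_projective_limit phi G].

Definition is_free_profinite_monoid (X : topologicalType)
    (F : topologicalMonoidType) (iota : X -> F) : Prop :=
  [/\ profinite_monoid F, continuous iota &
      forall (M : topologicalMonoidType) (f : X -> M),
        profinite_monoid M -> continuous f ->
        exists! g : F -> M,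
          [/\ continuous g, monoid_morphism g & forall x : X, g (iota x) = f x]].

(* The identity [e] of [H] need not be the identity of [M]. *)
Definition closed_subgroup (M : topologicalMonoidType) (H : set M) : Prop :=
  [/\ closed H,
      forall x y : M, H x -> H y -> H (x * y) &
      exists e : M, [/\ H e,
        forall x : M, H x -> e * x = x /\ x * e = x &
        forall x : M, H x -> exists y : M, [/\ H y, x * y = e & y * x = e]]].

(* Here [H] is coerced to the type of its elements, with the induced topology. *)
Definition isomorphic_to_subgroup (G : topologicalGroupType)
    (M : topologicalMonoidType) (H : set M) : Prop :=
  exists f : G -> H,
    homeomorphic_bijection f /\
    forall x y : G, set_val (f (x * y)) = set_val (f x) * set_val (f y).

Definition projective_group (G : topologicalGroupType) : Prop :=
  forall (A B : finGroupType) (alpha : A -> B) (phi : G -> B),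
    {morph alpha : x y / x * y} -> (forall b : B, exists a : A, alpha a = b) ->
    {morph phi : x y / x * y} -> (forall b : B, exists g : G, phi g = b) ->
    continuous (phi : G -> discrete_topology B) ->
    exists psi : G -> A,
      [/\ {morph psi : x y / x * y},
          continuous (psi : G -> discrete_topology A) &
          forall g : G, alpha (psi g) = phi g].

(* Main.v *)
From HB Require Import structures.
Require Import Defs.
From mathcomp Require Import all_boot all_order all_fingroup.
From mathcomp Require Import all_classical topology.

Set Implicit Arguments.
Unset Strict Implicit.
Unset Printing Implicit Defensive.

Local Open Scope classical_set_scope.
Local Open Scope group_scope.

(** Both directions rest on a short construction with finite monoids.

    Subgroups are projective. Let G be a subgroup of a free profinite monoid F,
    phi a continuous homomorphism of G onto a finite group B, and alpha an
    epimorphism of A onto B. Some continuous homomorphism from F to a finite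
    monoid M already determines phi on G. The image of G in M acts freely by
    left multiplication on the R-class of its identity e, so right
    multiplication by M is given by row-monomial matrices with entries in that
    image, hence, through phi, in B; this is the Schutzenberger representation
    ([schutzenberger_morphism]). An element of G is represented
    by a matrix whose row at e has its only nonzero entry on the diagonal, and
    that entry is the value of phi ([schutzenberger_diagonal]). Row-monomial
    matrices over A map onto those over B, and freeness of F lifts the
    representation to matrices over A. Reading the diagonal entry at e on G
    gives the lift of phi ([free_monoid_subgroup_projective]).

    Projective groups embed. Let F be the free profinite monoid on the space G,
    built as the inverse limit of the finite quotients of the monoid of words
    ([free_profinite_is_free]), and pi : F -> G the extension of the identity
    map. By compactness there is a minimal closed subsemigroup P with
    pi(P) = G. For x in P the translates xP and Px are again such
    subsemigroups, so xP = P = Px and P is a group ([minimal_covering_group]).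
    If s : F -> S is a continuous homomorphism to a finite monoid, let A be
    s(P) and B its quotient by the image of the kernel of pi on P; then G maps
    onto B, and projectivity lifts this map to lam : G -> A. The x in P with
    lam (pi x) = s x form a closed subsemigroup that still covers G, so they
    are all of P: thus s factors through pi on P, continuously in G
    ([finite_coordinate_rigid]). Taking all s, pi restricts to an isomorphism
    of topological groups from P to G ([projective_subgroup]). *)

(** * Inverse limits of finite monoids *)

Lemma continuous_discreteP (X : topologicalType) (S : choiceType) (f : X -> S) :
  continuous (f : X -> discrete_topology S) <->
  forall x, \forall y \near x, f y = f x.
Proof.
split=> [fc x|fc x U].
  have : nbhs (f x : discrete_topology S) [set f x].
    by rewrite nbhs_principalE; apply/principal_filterP.
  by move=> /(fc x).
rewrite nbhs_principalE => /principal_filterP Ufx.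
by rewrite /= nbhs_simpl /=; apply: filterS (fc x) => y /= ->.
Qed.

Lemma continuous_discrete_comp (X : topologicalType) (S T : choiceType)
    (f : X -> S) (h : S -> T) :
  continuous (f : X -> discrete_topology S) ->
  continuous (h \o f : X -> discrete_topology T).
Proof.
move=> /continuous_discreteP fc; apply/continuous_discreteP => x.
by apply: filterS (fc x) => y /= ->.
Qed.

Section Threads.
Variables (d : Order.disp_t) (I : porderType d) (S : I -> monoidType).
Variable phi : forall i j : I, (i <= j)%O -> S j -> S i.

Lemma thread_val (x : threads phi) (i j : I) (ij : (i <= j)%O) :
  phi ij (set_val x j) = set_val x i.
Proof. exact: set_mem (valP x) _ _ _. Qed.

Lemma coordinate_continuous (i : I) :
  continuous ((fun x => set_val x i) : threads phi -> discrete_topology (S i)).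
Proof.
move=> x; apply: (@continuous_comp _ _ _ (set_val : threads phi -> _) (proj i)).
  exact: initial_continuous.
exact: proj_continuous.
Qed.

(** Convergence in the limit is tested coordinatewise, where it means being
    eventually constant. *)
Lemma threads_cvg (F : set_system (threads phi)) (x : threads phi) :
  Filter F -> (forall i, F [set y | set_val y i = set_val x i]) -> F --> x.
Proof.
move=> FF Fx U [_ [[W oW <-] Wx WU]].
rewrite nbhs_filterE; apply: filterS WU _.
have Fval : Filter (set_val @ F) by exact: fmap_filter.
suff cv : set_val @ F --> (set_val x : prod_topology _).
  by apply: (cv W); apply: open_nbhs_nbhs.
apply/cvg_sup => i V [_ [[C oC <-] Cx CV]].
rewrite nbhs_filterE; apply: filterS CV _; rewrite nbhs_simpl /=.
by apply: filterS (Fx i) => y /= yx; rewrite /preimage /= yx.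
Qed.

Lemma into_threads_continuous (X : topologicalType) (f : X -> threads phi) :
  (forall i, continuous
    ((fun x => set_val (f x) i) : X -> discrete_topology (S i))) ->
  continuous f.
Proof.
move=> fc x; apply: threads_cvg => i.
by have /continuous_discreteP := fc i; exact.
Qed.

(** As the index set is directed, finitely many coordinates are controlled by a
    single one, so the fibres of the coordinate maps form a basis. *)
Lemma threads_nbhs (x : threads phi) (U : set (threads phi)) :
  inverse_system phi -> nbhs x U ->
  exists i, forall y : threads phi, set_val y i = set_val x i -> U y.
Proof.
move=> [[i0] dirI _ _ _].
pose F : set_system (threads phi) :=
  filter_from setT (fun i => [set y : threads phi | set_val y i = set_val x i]).
have FF : Filter F.
  apply: filter_from_filter; first by exists i0.
  move=> i j _ _; have [k [ik jk]] := dirI i j; exists k => // y /= yk.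
  by split; rewrite /= -(thread_val y ik, thread_val y jk)
                       -(thread_val x ik, thread_val x jk) yk.
have /(_ U) : F --> x by apply: threads_cvg => i; exists i.
by move=> FU /FU[i _ iU]; exists i.
Qed.

Lemma threads_closed : closed (threads phi).
Proof.
move=> x clx i j ij.
have ci (k : I) : nbhs x [set y | y k = x k].
  apply: (@proj_continuous I (fun i => discrete_topology (S i)) k x [set x k]).
  by rewrite nbhs_principalE; apply/principal_filterP.
have [y [yth [yi yj]]] := clx _ (filterI (ci i) (ci j)).
by rewrite -yi -yj; exact: yth.
Qed.

Lemma threads_compact :
  (forall i, finite_set [set: S i]) -> compact [set: threads phi].
Proof.
move=> finS.
have : compact (threads phi).
  apply: subclosed_compact threads_closed _ (subsetT _).
  rewrite (_ : setT =
    [set f : prod_topology (fun i => discrete_topology (S i)) |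
      forall i, [set: discrete_topology (S i)] (f i)]).
    apply: (@tychonoff I (fun i => discrete_topology (S i)) (fun=> setT)) => i.
    by apply: (@finite_compact (discrete_topology (S i))); exact: finS.
  by rewrite eqEsubset; split.
move=> cth F FF _.
have Fval : ProperFilter (set_val @ F) by exact: fmap_proper_filter.
have [|x [xth clx]] := cth (set_val @ F).
  by rewrite nbhs_simpl /=; apply: filterE => y; exact: set_mem (valP y).
exists (exist _ x (mem_set xth)); split=> // A B FA [_ [[W oW <-] Wx WB]].
have [_ [[y Ay <-] Wy]] : set_val @` A `&` W !=set0.
  apply: clx; last exact: open_nbhs_nbhs.
  by rewrite nbhs_simpl /=; apply: filterS FA => y Ay; exists y.
by exists y; split=> //; exact: WB.
Qed.

End Threads.

(** Lets a profinite monoid be handled through its finite images alone, without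
    reference to an inverse system. *)
Lemma profinite_coordinates (M : topologicalMonoidType) :
  profinite_monoid M ->
  compact [set: M] /\
  exists (I : Type) (S : I -> monoidType) (p : forall i, M -> S i),
    [/\ forall i, finite_set [set: S i],
        forall i, monoid_morphism (p i),
        forall i, continuous (p i : M -> discrete_topology (S i)),
        forall x y, (forall i, p i x = p i y) -> x = y &
        forall x U, nbhs x U -> exists i, forall y, p i y = p i x -> U y].
Proof.
move=> [d [I [S [phi [finS sysphi [f [[fc [g [gc fK gK]]] fM]]]]]]].
split.
  rewrite (_ : setT = g @` setT); last first.
    by rewrite eqEsubset; split=> // x _; exists (f x).
  apply: continuous_compact (threads_compact finS).
  exact: continuous_subspaceT.
exists I, S, (fun i x => set_val (f x) i); split=> // [i|x y xy|x U xU].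
- move=> x U /(@coordinate_continuous _ _ _ phi i (f x)).
  by move=> /(fc x).
- apply: (can_inj fK); apply/val_inj/functional_extensionality_dep => i.
  exact: xy.
have fxU : nbhs (f x) (g @^-1` U) by apply: gc; rewrite fK.
have [i iU] := threads_nbhs sysphi fxU.
by exists i => y /iU; rewrite /preimage /= fK.
Qed.

Lemma profinite_hausdorff (M : topologicalMonoidType) :
  profinite_monoid M -> hausdorff_space M.
Proof.
move=> /profinite_coordinates[_ [I [S [p [_ _ pc psep _]]]]] x y xy.
apply: psep => i.
have px (z : M) : nbhs z [set t | p i t = p i z].
  exact: (iffLR (continuous_discreteP _) (pc i)).
by have [t [tx ty]] := xy _ _ (px x) (px y); rewrite -tx -ty.
Qed.

Lemma profinite_group_monoid (G : topologicalGroupType) :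
  profinite_group G -> profinite_monoid G.
Proof.
by move=> [d [I [S [phi [finS sysphi limG]]]]]; exists d, I, S, phi.
Qed.

Section Limit.
Variables (d : Order.disp_t) (I : porderType d) (S : I -> monoidType).
Variable phi : forall i j : I, (i <= j)%O -> S j -> S i.

(** The proof that the transition maps are homomorphisms is an argument of the
    type, since the monoid operations depend on it. *)
Definition limit (sysphi : inverse_system phi) : Type := threads phi.

Variable sysphi : inverse_system phi.
Local Notation L := (limit sysphi).

HB.instance Definition _ := Topological.copy L (threads phi).

Lemma limit_one_subproof : threads phi (fun i => 1).
Proof.
by case: sysphi => _ _ phiM _ _ i j ij; have [] := phiM i j ij.
Qed.

Lemma limit_mul_subproof (x y : L) :
  threads phi (fun i => set_val x i * set_val y i).
Proof.
case: sysphi => _ _ phiM _ _ i j ij; have [_ ->] := phiM i j ij.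
by congr (_ * _); exact: thread_val.
Qed.

Definition limit_one : L := SigSub (mem_set limit_one_subproof).
Definition limit_mul (x y : L) : L :=
  SigSub (mem_set (limit_mul_subproof x y)).

Lemma limit_eq (x y : L) : (forall i, set_val x i = set_val y i) -> x = y.
Proof.
by move=> xy; apply/val_inj/functional_extensionality_dep => i; exact: xy.
Qed.

Lemma limit_mulA : associative limit_mul.
Proof. by move=> x y z; apply: limit_eq => i; exact: mulgA. Qed.
Lemma limit_mul1 : left_id limit_one limit_mul.
Proof. by move=> x; apply: limit_eq => i; exact: mul1g. Qed.
Lemma limit_mulr1 : right_id limit_one limit_mul.
Proof. by move=> x; apply: limit_eq => i; exact: mulg1. Qed.

HB.instance Definition _ :=
  monoid.isMonoid.Build L limit_mulA limit_mul1 limit_mulr1.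

Lemma limit_mul_continuous : continuous (fun p : L * L => p.1 * p.2).
Proof.
apply: into_threads_continuous => i; apply/continuous_discreteP => -[x y].
have ci (z : L) : nbhs z [set t | set_val t i = set_val z i].
  exact: (iffLR (continuous_discreteP _) (coordinate_continuous (i := i))).
exists ([set t | set_val t i = set_val x i],
        [set t | set_val t i = set_val y i]).
  by split; exact: ci.
move=> [s t] [/= sx ty].
by rewrite -[LHS]/(set_val s i * set_val t i) sx ty.
Qed.

HB.instance Definition _ := isTopologicalMonoid.Build L limit_mul_continuous.

Lemma coordinate_morphism (i : I) :
  monoid_morphism (fun x : L => set_val x i).
Proof. by split. Qed.

Lemma limit_profinite :
  (forall i, finite_set [set: S i]) -> profinite_monoid L.
Proof.
move=> finS; exists d, I, S, phi; split=> //.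
exists (fun x => x); split; last by move=> i; exact: coordinate_morphism.
by split; [move=> x|exists (fun x => x); split=> // x].
Qed.

End Limit.

(** * Finite monoids as profinite monoids *)

Section DiscreteMonoid.
Variable N : monoidType.

HB.instance Definition _ := monoid.Monoid.copy (discrete_topology N) N.

Lemma discrete_mul_continuous :
  continuous (fun p : discrete_topology N * discrete_topology N => p.1 * p.2).
Proof.
apply/continuous_discreteP => -[x y]; exists ([set x], [set y]).
  by split; rewrite nbhs_principalE; apply/principal_filterP.
by move=> [s t] /= [-> ->].
Qed.

HB.instance Definition _ :=
  isTopologicalMonoid.Build (discrete_topology N) discrete_mul_continuous.

Lemma discrete_profinite :
  finite_set [set: N] -> profinite_monoid (discrete_topology N).
Proof.
move=> finN.
(* A constant system over any directed order has limit N. *)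
pose phi (i j : bool) (_ : (i <= j)%O) (x : N) := x.
have th (x : N) : threads phi (fun=> x) by [].
exists _, bool, (fun=> N), phi; split=> //.
  split=> //; first exact: inhabits true.
  by move=> i j; exists true; case: i; case: j.
exists (fun x => SigSub (mem_set (th x))); split=> //; split.
  apply: (@into_threads_continuous _ _ _ phi) => i x.
  exact: cvg_id.
exists (fun t => set_val t true); split=> //.
  exact: (@coordinate_continuous _ _ _ phi true).
move=> t; apply/val_inj/functional_extensionality_dep => i.
have it : (i <= true)%O by case: i.
exact: (@thread_val _ _ _ phi t i true it).
Qed.

End DiscreteMonoid.

Section FiniteCarrier.
Variables (T : choiceType) (finT : finite_set [set: T]).

(** Finite functions need a finType, whereas finiteness is given as a
    proposition; this copy of [T] bridges the two, with elements unchanged. *)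
Definition finite_carrier of finite_set [set: T] : Type := T.
Local Notation FT := (finite_carrier finT).

HB.instance Definition _ := Choice.copy FT T.

Let elements : seq FT := undup (sval (cid (iffLR (finite_seqP _) finT))).

Let mem_elements (x : FT) : x \in elements.
Proof.
rewrite mem_undup; case: cid => s /= eq_s.
by have : [set: T] x by []; rewrite eq_s.
Qed.

Let elementsK : pcancel (fun x => index x elements) (onth elements).
Proof.
by move=> x; rewrite onthE (nth_map x) ?index_mem ?nth_index.
Qed.

HB.instance Definition _ := Choice_isCountable.Build FT elementsK.
HB.instance Definition _ :=
  isFinite.Build FT (Finite.uniq_enumP (undup_uniq _) mem_elements).

End FiniteCarrier.

Lemma finite_set_injective (T : Type) (F : finType) (f : T -> F) :
  injective f -> finite_set [set: T].
Proof.
move=> f_inj; apply: (@finite_preimage _ _ [set: F] f).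
  by move=> x y _ _; exact: f_inj.
exact: finite_finset.
Qed.

(** * Row-monomial matrices over a group *)

Section Monomial.
Variables (A : finGroupType) (Q : finType).

(** The square matrices indexed by [Q] over [A] with a zero adjoined, with at
    most one nonzero entry in each row: [f q = Some (a, q')] means that the
    nonzero entry of row [q] is [a], in column [q']. *)
Definition monomial : Type := {ffun Q -> option (A * Q)}.

HB.instance Definition _ := Finite.on monomial.

Definition shift (a : A) (r : option (A * Q)) : option (A * Q) :=
  omap (fun bq => (a * bq.1, bq.2)) r.

Definition monomial_one : monomial := [ffun q => Some (1, q)].
Definition monomial_mul (f g : monomial) : monomial :=
  [ffun q => obind (fun aq => shift aq.1 (g aq.2)) (f q)].

Lemma monomial_mulA : associative monomial_mul.
Proof.
move=> f g h; apply/ffunP => q; rewrite !ffunE.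
case: (f q) => [[a q']|] //=; rewrite !ffunE.
case: (g q') => [[b q'']|] //=.
by case: (h q'') => [[c q3]|] //=; rewrite mulgA.
Qed.

Lemma monomial_mul1 : left_id monomial_one monomial_mul.
Proof.
move=> f; apply/ffunP => q; rewrite !ffunE /=.
by case: (f q) => [[a q']|] //=; rewrite mul1g.
Qed.

Lemma monomial_mulr1 : right_id monomial_one monomial_mul.
Proof.
move=> f; apply/ffunP => q; rewrite !ffunE /=.
by case: (f q) => [[a q']|] //=; rewrite ffunE /= mulg1.
Qed.

HB.instance Definition _ :=
  monoid.isMonoid.Build monomial monomial_mulA monomial_mul1 monomial_mulr1.

Lemma monomial_mulE (f g : monomial) (q : Q) :
  (f * g) q = obind (fun aq => shift aq.1 (g aq.2)) (f q).
Proof. by rewrite ffunE. Qed.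

End Monomial.

Definition monomial_map (A B : finGroupType) (Q : finType) (h : A -> B)
    (f : monomial A Q) : monomial B Q :=
  [ffun q => omap (fun aq => (h aq.1, aq.2)) (f q)].

Lemma monomial_map_morphism (A B : finGroupType) (Q : finType) (h : A -> B) :
  {morph h : x y / x * y} -> monoid_morphism (@monomial_map A B Q h).
Proof.
move=> hM; have h1 : h 1 = 1 by apply: (mulgI (h 1)); rewrite -hM !mulg1.
split=> [|f g]; apply/ffunP => q; rewrite !ffunE /= ?h1 //.
case: (f q) => [[a q']|] //=; rewrite ffunE.
by case: (g q') => [[b q'']|] //=; rewrite hM.
Qed.

Lemma monomial_mapK (A B : finGroupType) (Q : finType)
    (h : A -> B) (s : B -> A) :
  cancel s h -> cancel (@monomial_map B A Q s) (@monomial_map A B Q h).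
Proof.
move=> sK f; apply/ffunP => q; rewrite !ffunE.
by case: (f q) => [[b q']|] //=; rewrite sK.
Qed.

(** * The Schutzenberger representation *)

Section Representation.
Variables (M : monoidType) (finM : finite_set [set: M]).
Variables (G : groupType) (p : G -> M).
Hypothesis pM : {morph p : x y / x * y}.
Variables (B : finGroupType) (phi : G -> B).
Hypothesis phiM : {morph phi : x y / x * y}.
Hypothesis ker_phi : forall g, p g = p 1 -> phi g = 1.

Local Notation e := (p 1).
Local Notation Q := (finite_carrier finM).

Let peM (g : G) : e * p g = p g. Proof. by rewrite -pM mul1g. Qed.
Let pMe (g : G) : p g * e = p g. Proof. by rewrite -pM mulg1. Qed.
Let pV (g : G) : p g * p g^-1 = e. Proof. by rewrite -pM mulgV. Qed.
Let pVl (g : G) : p g^-1 * p g = e. Proof. by rewrite -pM mulVg. Qed.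

Lemma phi_factor (g h : G) : p g = p h -> phi g = phi h.
Proof.
move=> gh; apply: (mulgI (phi h^-1)); rewrite -!phiM mulVg ker_phi.
  by rewrite ker_phi.
by rewrite pM gh pVl.
Qed.

(** Green's R-class of the idempotent [p 1]: the elements generating the same
    right ideal. *)
Definition rclass (x : M) : Prop := e * x = x /\ exists z, x * z = e.

Lemma rclass_act (g : G) (x : M) : rclass x -> rclass (p g * x).
Proof.
move=> [ex [z xz]]; split; first by rewrite mulgA peM.
by exists (z * p g^-1); rewrite -mulgA [x * _]mulgA xz peM pV.
Qed.

Lemma rclass_actE (g : G) (x : M) : e * x = x ->
  rclass (p g * x) <-> rclass x.
Proof.
move=> ex; split; last exact: rclass_act.
by move=> /(rclass_act g^-1); rewrite mulgA pVl ex.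
Qed.

(** The group acts freely: if [x * z] is the identity then [x] can be cancelled
    from the right. *)
Lemma rclass_free (g h : G) (x : M) :
  rclass x -> p g * x = p h * x -> phi g = phi h.
Proof.
move=> [_ [z xz]] ghx; apply: phi_factor.
by rewrite -(pMe g) -(pMe h) -xz !mulgA ghx.
Qed.

Lemma rclass_e : rclass e.
Proof. by split; [|exists e]; rewrite -pM mulg1. Qed.

Definition orbit (x : M) : set M := [set y | exists g, y = p g * x].

Lemma orbit_act (g : G) (x : M) : orbit (p g * x) = orbit x.
Proof.
apply/seteqP; split=> y [h ->]; first by exists (h * g); rewrite mulgA -pM.
by exists (h * g^-1); rewrite mulgA -pM mulgVK.
Qed.

(** Representing the orbit of [e] by [e] itself puts the diagonal entry of
    interest in row [e]. *)
Definition rep (x : M) : M :=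
  if `[< orbit x e >] then e else xget 1 (orbit x).

Lemma rep_act (g : G) (x : M) : rep (p g * x) = rep x.
Proof. by rewrite /rep orbit_act. Qed.

Lemma rep_orbit (x : M) : exists g, rep x = p g * x.
Proof.
rewrite /rep; case: asboolP => // _.
by have /(xgetPex 1) : exists y, orbit x y by exists (e * x), 1.
Qed.

Lemma rep_rep (x : M) : rep (rep x) = rep x.
Proof. by have [g {1}->] := rep_orbit x; rewrite rep_act. Qed.

Lemma rep_e (g : G) : rep (p g) = e.
Proof.
rewrite -(pMe g) rep_act /rep; case: asboolP => // -[]; exists 1.
by rewrite pMe.
Qed.

(** The group element carrying the representative of the orbit of [x] to [x],
    pushed forward to [B]. On the R-class the action is free, so the value does
    not depend on the element chosen. *)
Definition coord (x : M) : B := phi (xget 1 [set g | p g * rep x = x]).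

Lemma coordP (g : G) (x : M) : rclass x -> p g * rep x = x -> coord x = phi g.
Proof.
move=> Rx gx; have : exists g, p g * rep x = x by exists g.
move=> /(xgetPex 1) /= kx; apply: (@rclass_free _ _ (rep x)); last first.
  by rewrite gx kx.
by have [h ->] := rep_orbit x; exact: rclass_act.
Qed.

Lemma coord_ex (x : M) : rclass x -> exists g, p g * rep x = x.
Proof.
move=> [ex _]; have [g ->] := rep_orbit x.
by exists g^-1; rewrite mulgA pVl.
Qed.

Lemma coord_act (g : G) (x : M) : rclass x -> coord (p g * x) = phi g * coord x.
Proof.
move=> Rx; have [h hx] := coord_ex Rx; rewrite (coordP Rx hx) -phiM.
by apply: coordP; [exact: rclass_act|rewrite rep_act pM -mulgA hx].
Qed.

Definition is_rep (t : M) : Prop := rclass t /\ rep t = t.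

(** Row [t], for an orbit representative [t], records the position of [t * m]:
    its coordinate and its orbit, or zero if the R-class has been left. The rows
    at the other elements of [M] are those of the identity matrix, which makes
    [M] itself usable as the set of rows. *)
Definition schutzenberger (m : M) : monomial B Q :=
  [ffun t : Q => if `[< is_rep t >] then
      if `[< rclass ((t : M) * m) >] then
        Some (coord ((t : M) * m), rep ((t : M) * m) : Q)
      else None
    else Some (1, t)].

Lemma schutzenberger_morphism : monoid_morphism schutzenberger.
Proof.
split=> [|m n]; apply/ffunP => t.
  rewrite !ffunE; case: asboolP => // -[Rt tt]; rewrite !mulg1.
  have et : p 1 * rep t = t by rewrite tt; case: Rt.
  rewrite (coordP Rt et) tt; case: asboolP => // _.
  by rewrite -(ker_phi (erefl (p 1))).
rewrite monomial_mulE !ffunE; case: asboolP => [[Rt tt]|nt] /=; last first.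
  by rewrite !ffunE; case: asboolP => //= _; rewrite mulg1.
case: (asboolP (rclass (t * m))) => [Rtm|Rtm] /=; last first.
  case: asboolP => // -[_ [z tz]]; case: Rtm; split.
    by rewrite mulgA; case: Rt => ->.
  by exists (n * z); rewrite mulgA -(mulgA t).
have [k kx] := coord_ex Rtm; have [h hx] := rep_orbit (t * m).
have Rt' : rclass (rep (t * m)) by rewrite hx; exact: rclass_act.
have repr : is_rep (rep (t * m)) by split; [|exact: rep_rep].
rewrite ffunE (asboolT repr).
have tmn : t * (m * n) = p k * (rep (t * m) * n) by rewrite !mulgA kx.
have Rk : rclass (t * (m * n)) <-> rclass (rep (t * m) * n).
  by rewrite tmn; apply: rclass_actE; rewrite mulgA; case: Rt' => ->.
case: (asboolP (rclass (rep (t * m) * n))) => [/[dup] R' /Rk R|/Rk R].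
  case: asboolP => // _ /=.
  by rewrite tmn rep_act coord_act // (coordP Rtm kx).
by case: asboolP.
Qed.

(** Right multiplication by the group preserves the orbit of [p 1], which is
    the group itself. *)
Lemma schutzenberger_diagonal (g : G) :
  schutzenberger (p g) (e : Q) = Some (phi g, e : Q).
Proof.
have re : rep e = e := rep_e 1.
rewrite ffunE; case: asboolP => [_|]; last by case; split=> //; exact: rclass_e.
have Rg : rclass (p g) by rewrite -(pMe g); apply: rclass_act rclass_e.
rewrite peM; case: asboolP => // _; congr (Some (_, _)); last exact: rep_e.
by apply: coordP => //; rewrite rep_e pMe.
Qed.

End Representation.

(** * Subgroups of free profinite monoids are projective *)

Lemma free_extension (X : topologicalType) (F : topologicalMonoidType)
    (iota : X -> F) (N : monoidType) (f : X -> N) :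
  is_free_profinite_monoid iota -> finite_set [set: N] ->
  continuous (f : X -> discrete_topology N) ->
  exists g : F -> N, [/\ continuous (g : F -> discrete_topology N),
    monoid_morphism g & forall x, g (iota x) = f x].
Proof.
move=> [_ _ freeF] finN fc.
by have [g [gP _]] := freeF (discrete_topology N) f (discrete_profinite finN) fc;
  exists g.
Qed.

Lemma free_unique (X : topologicalType) (F : topologicalMonoidType)
    (iota : X -> F) (N : monoidType) (g h : F -> N) :
  is_free_profinite_monoid iota -> finite_set [set: N] ->
  continuous (g : F -> discrete_topology N) -> monoid_morphism g ->
  continuous (h : F -> discrete_topology N) -> monoid_morphism h ->
  (forall x, g (iota x) = h (iota x)) -> g = h.
Proof.
move=> [_ iotac freeF] finN gc gM hc hM gh.
have gic : continuous (g \o iota : X -> discrete_topology N).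
  by move=> x; exact: continuous_comp (iotac x) (gc (iota x)).
have [k [_ uniqk]] :=
  freeF (discrete_topology N) (g \o iota) (discrete_profinite finN) gic.
rewrite -(uniqk g); last by split.
by apply: uniqk; split=> // x; rewrite /= gh.
Qed.

(** The last hypothesis on [inc] says that it is an embedding, tested at the
    identity of the group. *)
Lemma free_monoid_subgroup_projective (X : topologicalType)
    (F : topologicalMonoidType) (iota : X -> F) (G : topologicalGroupType)
    (inc : G -> F) :
  is_free_profinite_monoid iota -> {morph inc : x y / x * y} ->
  continuous inc ->
  (forall U, nbhs (1 : G) U -> exists2 V, nbhs (inc 1) V & inc @^-1` V `<=` U) ->
  projective_group G.
Proof.
move=> freeF incM incc incV A B alpha phi alphaM alphaS phiM _ phic.
have [Fprof iotac _] := freeF.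
have [_ [I [S [pi [finS piM pic _ pinbhs]]]]] := profinite_coordinates Fprof.
(* The kernel of phi is open, so a single finite coordinate of F decides it. *)
have [i iphi] : exists i, forall g, pi i (inc g) = pi i (inc 1) -> phi g = 1.
  have [V V1 VU] := incV _ (iffLR (continuous_discreteP _) phic 1).
  have [i iV] := pinbhs _ _ V1; exists i => g /iV /VU /= ->.
  by apply: (mulgI (phi 1)); rewrite -phiM !mulg1.
pose p g := pi i (inc g).
have pM : {morph p : x y / x * y} by move=> x y; rewrite /p incM (piM i).2.
pose Q := finite_carrier (finS i).
pose rho : S i -> monomial B Q := schutzenberger (finS i) p phi.
have rhoM : monoid_morphism rho by exact: schutzenberger_morphism.
have [sec secK] : exists s : B -> A, cancel s alpha.
  by have [s] := choice alphaS; exists s.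
have finN (C : finGroupType) : finite_set [set: monomial C Q].
  exact: finite_finset.
have fc : continuous (monomial_map sec \o (rho \o (pi i \o iota)) :
    X -> discrete_topology (monomial A Q)).
  do 2!apply: continuous_discrete_comp.
  by move=> x; exact: continuous_comp (iotac x) (pic i (iota x)).
have [sigma [sigmac sigmaM sigmaE]] := free_extension freeF (finN A) fc.
have mapM := monomial_map_morphism Q alphaM.
have sigma_rho : monomial_map alpha \o sigma = rho \o pi i.
  apply: (free_unique freeF (finN B)).
  - exact: continuous_discrete_comp.
  - by split=> [|x y] /=; rewrite sigmaM mapM.
  - by apply: continuous_discrete_comp; exact: pic.
  - by split=> [|x y] /=; rewrite (piM i) rhoM.
  by move=> x /=; rewrite sigmaE; exact: monomial_mapK.
pose e : Q := p 1.
have diag g : exists2 a, sigma (inc g) e = Some (a, e) & alpha a = phi g.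
  have : monomial_map alpha (sigma (inc g)) e = Some (phi g, e).
    have /(congr1 (fun h => h (inc g))) /= -> := sigma_rho.
    exact: schutzenberger_diagonal.
  by rewrite ffunE; case: (sigma (inc g) e) => [[a q]|] //= [<- <-]; exists a.
pose psi g := if sigma (inc g) e is Some (a, _) then a else 1.
exists psi; split.
- move=> g h; rewrite /psi incM sigmaM monomial_mulE.
  have [a -> _] := diag g; have [b hb _] := diag h.
  by rewrite /= hb.
- apply: (continuous_discrete_comp (S := monomial A Q)
    (h := fun f => if f e is Some (a, _) then a else 1)).
  by move=> g; exact: continuous_comp (incc g) (sigmac (inc g)).
- by move=> g; rewrite /psi; have [a ->] := diag g.
Qed.

(** * Quotients of monoids by congruences *)

Definition is_congruence (W : monoidType) (r : W -> W -> Prop) : Prop :=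
  [/\ forall x, r x x, forall x y, r x y -> r y x,
      forall x y z, r x y -> r y z -> r x z &
      forall x y z t, r x y -> r z t -> r (x * z) (y * t)].

Definition congruence (W : monoidType) : Type :=
  {r : W -> W -> Prop | is_congruence r}.

Section Quotient.
Variables (W : monoidType) (c : congruence W).

Definition quotient : Type := {C : set W | exists w, C = sval c w}.

HB.instance Definition _ := gen_eqMixin quotient.
HB.instance Definition _ := gen_choiceMixin quotient.

Definition cls (w : W) : quotient :=
  exist _ (sval c w) (ex_intro _ w erefl).

Definition repr (q : quotient) : W := sval (cid (svalP q)).

Lemma reprK : cancel repr cls.
Proof.
move=> q; apply: eq_sig_hprop => [C P Q|/=]; first exact: Prop_irrelevance.
by rewrite /repr; case: cid => w /= ->.
Qed.

Lemma clsP (v w : W) : cls v = cls w <-> sval c v w.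
Proof.
have [cR cS cT _] := svalP c; split=> [[eqvw]|vw].
  by rewrite eqvw; exact: cR.
apply: eq_sig_hprop => [C P Q|/=]; first exact: Prop_irrelevance.
apply/funext => x; apply/propext; split; apply: cT => //; exact: cS.
Qed.

Lemma repr_cls (w : W) : sval c (repr (cls w)) w.
Proof. by apply/clsP; rewrite reprK. Qed.

Definition quotient_mul (x y : quotient) : quotient := cls (repr x * repr y).

Lemma cls_mul (v w : W) : cls (v * w) = quotient_mul (cls v) (cls w).
Proof.
have [_ cS _ cM] := svalP c.
by apply/clsP; apply: cM; apply: cS; exact: repr_cls.
Qed.

Lemma quotient_mulA : associative quotient_mul.
Proof.
by move=> x y z; rewrite -(reprK x) -(reprK y) -(reprK z) -!cls_mul mulgA.
Qed.

Lemma quotient_mul1 : left_id (cls 1) quotient_mul.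
Proof. by move=> x; rewrite -(reprK x) -cls_mul mul1g. Qed.

Lemma quotient_mulr1 : right_id (cls 1) quotient_mul.
Proof. by move=> x; rewrite -(reprK x) -cls_mul mulg1. Qed.

HB.instance Definition _ := monoid.isMonoid.Build quotient
  quotient_mulA quotient_mul1 quotient_mulr1.

Lemma cls_morphism : monoid_morphism cls.
Proof. by split=> // x y; exact: cls_mul. Qed.

(** The quotient is finite; stated with a map to a finite type, so that the
    conjunction of two congruences of finite index is plainly of finite index. *)
Definition finite_index : Prop :=
  exists (Z : finType) (f : W -> Z), forall v w, f v = f w -> sval c v w.

Lemma finite_quotient : finite_index -> finite_set [set: quotient].
Proof.
move=> [Z [f fc]]; apply: (@finite_set_injective _ Z (f \o repr)) => x y /fc.
by move=> /clsP; rewrite !reprK.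
Qed.

End Quotient.

Section GroupQuotient.
Variables (W : groupType) (c : congruence W).
Variable finc : finite_set [set: quotient c].

Definition group_quotient of finite_set [set: quotient c] : Type := quotient c.
Local Notation A := (group_quotient finc).

HB.instance Definition _ := Finite.copy A (finite_carrier finc).

Definition group_quotient_inv (x : A) : A := cls c (repr x)^-1.

Lemma group_quotient_mulV :
  left_inverse (cls c 1 : A) group_quotient_inv (@quotient_mul W c).
Proof.
move=> x; rewrite -{2}(reprK x) /group_quotient_inv -cls_mul.
by rewrite mulVg.
Qed.

HB.instance Definition _ := Finite_isGroup.Build A
  (@quotient_mulA W c) (@quotient_mul1 W c) group_quotient_mulV.

End GroupQuotient.

Lemma finite_group_quotient (W : groupType) (c : congruence W) :
  finite_index c ->
  exists (A : finGroupType) (q : W -> A),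
    [/\ {morph q : x y / x * y}, forall a, exists w, q w = a &
        forall v w, q v = q w <-> sval c v w].
Proof.
move=> /finite_quotient finc; exists (group_quotient finc), (cls c); split.
- exact: cls_mul.
- by move=> a; exists (repr a); exact: reprK.
- exact: clsP.
Qed.

Definition kernel_relation (W N : monoidType) (h : W -> N) (v w : W) : Prop :=
  h v = h w.

Lemma kernel_is_congruence (W N : monoidType) (h : W -> N) :
  {morph h : x y / x * y} -> is_congruence (kernel_relation h).
Proof.
move=> hM; rewrite /kernel_relation.
split=> // [x y z -> -> //|x y z t xy zt]; by rewrite !hM xy zt.
Qed.

(** * Free profinite monoids *)

Definition words (X : Type) : Type := seq X.

HB.instance Definition _ (X : choiceType) := Choice.copy (words X) (seq X).
HB.instance Definition _ (X : choiceType) := monoid.isMonoid.Build (words X)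
  (@catA X) (@cat0s X) (@cats0 X).

(** The extension of [u] to a homomorphism on words. *)
Definition word_value (X : Type) (M : monoidType) (u : X -> M) (w : words X) : M :=
  foldr (fun x m => u x * m) 1 w.

Lemma word_value_morphism (X : choiceType) (M : monoidType) (u : X -> M) :
  monoid_morphism (word_value u).
Proof.
split=> // v w; elim: v => [|x v IHv] /=; first by rewrite !mul1g.
by rewrite -mulgA -IHv.
Qed.

Lemma word_ind_morphism (X : choiceType) (N : monoidType) (g h : words X -> N) :
  monoid_morphism g -> monoid_morphism h ->
  (forall x, g [:: x] = h [:: x]) -> g =1 h.
Proof.
move=> gM hM gh; elim=> [|x w IHw].
  by rewrite -[[::]]/(1 : words X) gM hM.
rewrite -[x :: w]/(([:: x] : words X) * w).
by rewrite gM hM gh IHw.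
Qed.

Section FreeProfinite.
Variable X : topologicalType.

(** Continuity of the quotient map on letters is what makes the map from [X] to
    the limit continuous. *)
Definition admissible (c : congruence (words X)) : Prop :=
  finite_index c /\
  forall x, nbhs x [set y | sval c ([:: y] : words X) ([:: x] : words X)].

Definition fin_cong : Type := {c : congruence (words X) | admissible c}.

HB.instance Definition _ := gen_eqMixin fin_cong.
HB.instance Definition _ := gen_choiceMixin fin_cong.

Definition fin_cong_le (c e : fin_cong) : bool :=
  `[< forall v w, sval (sval e) v w -> sval (sval c) v w >].

Lemma fin_cong_le_refl : reflexive fin_cong_le.
Proof. by move=> c; apply/asboolP. Qed.

Lemma fin_cong_le_anti : antisymmetric fin_cong_le.
Proof.
move=> c e /andP[/asboolP ce /asboolP ec].
apply: eq_sig_hprop => [x P Q|]; first exact: Prop_irrelevance.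
apply: eq_sig_hprop => [x P Q|]; first exact: Prop_irrelevance.
apply/funext => v; apply/funext => w; apply/propext.
by split; [exact: ec|exact: ce].
Qed.

Lemma fin_cong_le_trans : transitive fin_cong_le.
Proof.
move=> c e f /asboolP ec /asboolP cf; apply/asboolP => v w /cf; exact: ec.
Qed.

HB.instance Definition _ := Order.Le_isPOrder.Build (Order.Disp tt tt) fin_cong
  fin_cong_le_refl fin_cong_le_anti fin_cong_le_trans.

Lemma fin_cong_leP (c e : fin_cong) :
  (c <= e)%O <-> forall v w, sval (sval e) v w -> sval (sval c) v w.
Proof. by split=> [/asboolP|ce]; [|apply/asboolP]. Qed.

Lemma fin_cong_directed (c e : fin_cong) :
  exists k : fin_cong, (c <= k)%O /\ (e <= k)%O.
Proof.
pose r v w := sval (sval c) v w /\ sval (sval e) v w.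
have rC : is_congruence r.
  have [cR cS cT cM] := svalP (sval c); have [eR eS eT eM] := svalP (sval e).
  split=> [x|x y [cxy exy]|x y z [cxy exy] [cyz eyz]|x y z t [cxy exy] [czt ezt]].
  - by split.
  - by split; [exact: cS|exact: eS].
  - by split; [exact: cT cyz|exact: eT eyz].
  - by split; [exact: cM|exact: eM].
have rA : admissible (exist _ r rC).
  have [[Y [f fc]] cX] := svalP c; have [[Z [g ge]] eX] := svalP e; split.
    exists (Y * Z)%type, (fun w => (f w, g w)) => v w [/fc ? /ge ?].
    by split.
  by move=> x; exact: filterI (cX x) (eX x).
exists (exist _ _ rA); split; apply/fin_cong_leP => v w; by case.
Qed.

Definition finite_words_quotient (c : fin_cong) : monoidType := quotient (sval c).

Definition transition (c e : fin_cong) (_ : (c <= e)%O)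
    (q : finite_words_quotient e) : finite_words_quotient c :=
  cls (sval c) (repr q).

Lemma transition_cls (c e : fin_cong) (ce : (c <= e)%O) (w : words X) :
  transition ce (cls (sval e) w) = cls (sval c) w.
Proof. by apply/clsP; apply: (iffLR (fin_cong_leP c e) ce); exact: repr_cls. Qed.

Lemma transition_system : inverse_system transition.
Proof.
split.
- have rC : is_congruence (fun _ _ : words X => True) by [].
  have rA : admissible (exist _ _ rC).
    split; last by move=> x; exact: filterT.
    by exists unit, (fun=> tt).
  exact: inhabits (exist _ _ rA).
- exact: fin_cong_directed.
- move=> c e ce; split=> [|x y]; first exact: transition_cls.
  rewrite -(reprK x) -(reprK y) -(cls_morphism _).2 !transition_cls.
  exact: (cls_morphism _).2.
- by move=> c cc x; rewrite -(reprK x) transition_cls.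
- by move=> c e f ce ef cf x; rewrite -(reprK x) !transition_cls.
Qed.

Definition free_profinite : topologicalMonoidType := limit transition_system.

Lemma free_profinite_profinite : profinite_monoid free_profinite.
Proof.
by apply: limit_profinite => c; apply: finite_quotient; case: (svalP c).
Qed.

Lemma word_thread (w : words X) : threads transition (fun c => cls (sval c) w).
Proof. by move=> c e ce; exact: transition_cls. Qed.

Definition word_limit (w : words X) : free_profinite :=
  SigSub (mem_set (word_thread w)).

Lemma word_limit_morphism : monoid_morphism word_limit.
Proof.
split=> [|v w]; apply: limit_eq => c //.
exact: (cls_morphism _).2.
Qed.

Definition letter (x : X) : free_profinite := word_limit [:: x].

Lemma letter_continuous : continuous letter.
Proof.
apply: (@into_threads_continuous _ _ _ transition) => c.
apply/continuous_discreteP => x; have [_ cX] := svalP c.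
by apply: filterS (cX x) => y yx; apply/clsP.
Qed.

(** The words are dense: each point agrees in any given coordinate with a word,
    namely a representative of that coordinate. *)
Lemma free_profinite_unique (N : monoidType) (g h : free_profinite -> N) :
  continuous (g : free_profinite -> discrete_topology N) -> monoid_morphism g ->
  continuous (h : free_profinite -> discrete_topology N) -> monoid_morphism h ->
  (forall x, g (letter x) = h (letter x)) -> g =1 h.
Proof.
move=> gc gM hc hM gh x.
have U : nbhs x [set y | g y = g x /\ h y = h x].
  by apply: filterI; exact: (iffLR (continuous_discreteP _) _ x).
have [c cU] := threads_nbhs transition_system U.
pose w := repr (set_val x c : finite_words_quotient c).
have [gw hw] : g (word_limit w) = g x /\ h (word_limit w) = h x.
  by apply: cU; exact: reprK.
rewrite -gw -hw.
apply: (@word_ind_morphism X N (g \o word_limit) (h \o word_limit)) => //.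
- by split=> [|u v] /=; rewrite word_limit_morphism gM.
- by split=> [|u v] /=; rewrite word_limit_morphism hM.
Qed.

(** Each finite coordinate of the target pulls back to an admissible congruence
    on words, through which that coordinate of the extension factors. *)
Lemma free_profinite_is_free : is_free_profinite_monoid letter.
Proof.
split; [exact: free_profinite_profinite|exact: letter_continuous|].
move=> M u [d [I [S [phi [finS sysphi [f [[fc [f' [f'c fK f'K]]] fM]]]]]]] uc.
pose h j (w : words X) : S j := set_val (f (word_value u w)) j.
have hM j : monoid_morphism (h j).
  by split=> [|v w]; rewrite /h word_value_morphism (fM j).
have hL j x : h j [:: x] = set_val (f (u x)) j by rewrite /h /= mulg1.
have coordc (Y : topologicalType) (v : Y -> M) j : continuous v ->
    continuous ((fun y => set_val (f (v y)) j) : Y -> discrete_topology (S j)).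
  move=> vc y U /(@coordinate_continuous _ _ _ phi j (f (v y))).
  by move=> /(fc (v y)) /(vc y).
have hA j : admissible (exist _ _ (kernel_is_congruence (hM j).2)).
  split; first by exists (finite_carrier (finS j)), (h j).
  move=> x; apply: filterS (iffLR (continuous_discreteP _) (coordc _ _ j uc) x).
  by move=> y /= yx; rewrite /kernel_relation !hL.
pose idx j : fin_cong := exist _ _ (hA j).
have hphi i j (ij : (i <= j)%O) w : phi i j ij (h j w) = h i w.
  exact: (@thread_val _ _ _ phi).
have hrepr j w : h j (repr (cls (sval (idx j)) w)) = h j w.
  exact: (repr_cls (sval (idx j)) w).
pose g0 (x : free_profinite) j : S j :=
  h j (repr (set_val x (idx j) : finite_words_quotient (idx j))).
have g0t x : threads phi (g0 x).
  move=> i j ij; rewrite /g0 hphi.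
  have idx_le : (idx i <= idx j)%O.
    apply/fin_cong_leP => v w; rewrite /= /kernel_relation.
    by rewrite -!(hphi i j ij) => ->.
  by rewrite -[in RHS](@thread_val _ _ _ transition x _ _ idx_le) hrepr.
pose g1 x : threads phi := SigSub (mem_set (g0t x)).
have fgE x j : set_val (f (f' (g1 x))) j = g0 x j by rewrite f'K.
have f_eq (x y : M) : (forall j, set_val (f x) j = set_val (f y) j) -> x = y.
  move=> xy; apply: (can_inj fK); apply/val_inj/functional_extensionality_dep.
  exact: xy.
have gc : continuous (f' \o g1).
  move=> x; apply: continuous_comp; last exact: f'c.
  apply: into_threads_continuous => j.
  apply: (continuous_discrete_comp (S := finite_words_quotient (idx j))
    (h := fun q => h j (repr q))).
  exact: (@coordinate_continuous _ _ _ transition).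
have gM : monoid_morphism (f' \o g1).
  split=> [|x y]; apply: f_eq => j.
    by rewrite fgE (fM j) -(hM j).1; exact: hrepr.
  rewrite (fM j) !fgE -(hM j).2; exact: hrepr.
have gL x : (f' \o g1) (letter x) = u x.
  by apply: f_eq => j; rewrite fgE -hL; exact: hrepr.
exists (f' \o g1); split=> [//|g2 [g2c g2M g2L]].
apply/funext => x; apply: f_eq => j.
apply: (@free_profinite_unique (S j) (fun x => set_val (f ((f' \o g1) x)) j)
  (fun x => set_val (f (g2 x)) j)).
- exact: coordc.
- by split=> [|y z]; rewrite gM (fM j).
- exact: coordc.
- by split=> [|y z]; rewrite g2M (fM j).
- by move=> y; rewrite gL g2L.
Qed.

End FreeProfinite.

(** * Minimal closed subsemigroups covering a group *)

(** A nonempty semigroup in which the equations xz = y and zx = y are always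
    solvable is a group. The group is returned as a type with an injection,
    since its identity is in general not that of [M]. *)
Lemma divisible_semigroup_group (M : monoidType) (P : set M) :
  P !=set0 -> (forall x y, P x -> P y -> P (x * y)) ->
  (forall x y, P x -> P y -> exists2 z, P z & x * z = y) ->
  (forall x y, P x -> P y -> exists2 z, P z & z * x = y) ->
  exists (H : groupType) (j : H -> M),
    [/\ injective j, {morph j : x y / x * y} & range j = P].
Proof.
move=> [x0 Px0] PM divr divl.
have [e Pe x0e] := divr _ _ Px0 Px0; have [e' Pe' ex0] := divl _ _ Px0 Px0.
have mule y : P y -> y * e = y.
  by move=> Py; have [z _ <-] := divl _ _ Px0 Py; rewrite -mulgA x0e.
have emul y : P y -> e' * y = y.
  by move=> Py; have [z _ <-] := divr _ _ Px0 Py; rewrite mulgA ex0.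
have ee' : e' = e by rewrite -(mule e') // emul.
rewrite {}ee' in emul {ex0 Pe'}.
pose T := set_type P.
have mulT (x y : T) : P (set_val x * set_val y).
  by apply: PM; exact: set_mem (valP _).
pose mul (x y : T) : T := SigSub (mem_set (mulT x y)).
pose one : T := SigSub (mem_set Pe).
have invT (x : T) : exists y : T, mul y x = one.
  have [y Py yx] := divl _ _ (set_mem (valP x)) Pe.
  by exists (SigSub (mem_set Py)); apply: val_inj.
have [inv mulV] := choice invT.
have mulA : associative mul by move=> x y z; apply: val_inj; exact: mulgA.
have mul1 : left_id one mul.
  by move=> x; apply: val_inj; exact: emul (set_mem (valP x)).
have mulr1 : right_id one mul.
  by move=> x; apply: val_inj; exact: mule (set_mem (valP x)).
have mulrV : right_inverse one inv mul.
  move=> x; rewrite -[LHS]mul1 -{1}(mulV (inv x)) -mulA (mulA (inv x)) mulV.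
  by rewrite mul1 mulV.
pose H : groupType :=
  HB.pack T (monoid.isGroup.Build T mulA mul1 mulr1 mulV mulrV).
exists H, (fun x : T => set_val x); split=> //.
apply/seteqP; split=> [_ [x _ <-]|x Px]; first exact: set_mem (valP x).
by exists (SigSub (mem_set Px)).
Qed.

Section Cover.
Variables (F : topologicalMonoidType) (G : topologicalGroupType).
Hypotheses (profF : profinite_monoid F) (hausG : hausdorff_space G).
Variable pi : F -> G.
Hypotheses (pic : continuous pi) (piM : {morph pi : x y / x * y}).

Definition covering (P : set F) : Prop :=
  [/\ closed P, forall x y, P x -> P y -> P (x * y) & pi @` P = setT].

Let compactF : compact [set: F].
Proof. by have [] := profinite_coordinates profF. Qed.
Let hausF : hausdorff_space F. Proof. exact: profinite_hausdorff. Qed.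

Lemma closed_compact (P : set F) : closed P -> compact P.
Proof. by move=> clP; exact: subclosed_compact clP compactF (subsetT _). Qed.

(** Zorn's lemma, applied to complements: a chain of covering sets has a
    covering intersection because the fibres of [pi] are compact. *)
Lemma minimal_covering : (forall g, exists x, pi x = g) ->
  exists P, covering P /\ forall Q, covering Q -> Q `<=` P -> P `<=` Q.
Proof.
move=> piS.
have chain (D : set (set F)) : D `<=` (fun C => covering (~` C)) ->
    total_on D subset -> covering (~` \bigcup_(C in D) C).
  move=> Dcov totD; rewrite setC_bigcup; split.
  - by apply: closed_bigI => C /Dcov[].
  - by move=> x y Dx Dy C DC;
    have [_ CM _] := Dcov _ DC; apply: CM; [exact: Dx|exact: Dy].
  apply/seteqP; split=> // g _.
  have clg : closed (pi @^-1` [set g]).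
    apply: preimage_closed; first by move=> x _; exact: pic.
    by apply: compact_closed => //; exact: compact_set1.
  have [[C0 DC0]|D0] := pselect (exists C, D C); last first.
    by have [x xg] := piS g; exists x => // C DC; case: D0; exists C.
  (* The fibres over g of the members of the chain have the finite intersection
     property, so they meet. *)
  pose E := filter_from D (fun C => ~` C `&` pi @^-1` [set g]).
  have EF : ProperFilter E.
    apply: filter_from_proper; last first.
      move=> C /Dcov[_ _ CS]; have : [set: G] g by [].
      by rewrite -CS => -[x Cx xg]; exists x.
    apply: filter_from_filter; first by exists C0.
    move=> C C' DC DC'; have [CC'|C'C] := totD _ _ DC DC'.
      by exists C' => // x [C'x xg]; split; split=> // /CC'.
    by exists C => // x [Cx xg]; split; split=> // /C'C.
  have [x [_]] := compactF EF (filterT : E setT).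
  rewrite clusterE => clx.
  have xC C : D C -> (~` C `&` pi @^-1` [set g]) x.
    move=> DC; have [clC _ _] := Dcov _ DC.
    by apply: (closedI clC clg); apply: clx; exists C.
  by exists x => [C DC|]; [have [] := xC C DC|have [] := xC C0 DC0].
have [C [covC Cmax]] := Zorn_bigcup chain.
exists (~` C); split=> // Q covQ QC.
apply: contrapT => nQ; apply: (Cmax (~` Q)); last by rewrite setCK.
split; first by move=> x Cx /QC.
by move=> QCC; apply: nQ => x nCx; apply: contrapT => /QCC.
Qed.

(** Stated for an arbitrary map [t] so as to serve for the left and the right
    translations. *)
Lemma translate_covering (P : set F) (t : F -> F) :
  covering P -> continuous t ->
  (forall y z, P y -> P z -> exists2 w, P w & t y * t z = t w) ->
  (forall g, exists h, forall y, pi y = h -> pi (t y) = g) ->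
  covering (t @` P).
Proof.
move=> [clP PM PS] tc tM tS; split.
- apply: compact_closed hausF _; apply: continuous_compact (closed_compact clP).
  exact: continuous_subspaceT.
- move=> _ _ [y Py <-] [z Pz <-]; have [w Pw ->] := tM y z Py Pz.
  by exists w.
apply/seteqP; split=> // g _; have [h hg] := tS g.
have : [set: G] h by []; rewrite -PS => -[y Py yh].
by exists (t y); [exists y|exact: hg].
Qed.

Lemma minimal_covering_group (P : set F) :
  covering P -> (forall Q, covering Q -> Q `<=` P -> P `<=` Q) ->
  exists (H : groupType) (j : H -> F),
    [/\ injective j, {morph j : x y / x * y} & range j = P].
Proof.
move=> covP Pmin; have [clP PM PS] := covP.
have cR x : continuous (fun y : F => x * y).
  move=> y; apply: (@continuous_comp _ _ _ (fun y => (x, y)) (fun p => p.1 * p.2)).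
    by apply: cvg_pair; [exact: cvg_cst|exact: cvg_id].
  exact: mulg_continuous.
have cL x : continuous (fun y : F => y * x).
  move=> y; apply: (@continuous_comp _ _ _ (fun y => (y, x)) (fun p => p.1 * p.2)).
    by apply: cvg_pair; [exact: cvg_id|exact: cvg_cst].
  exact: mulg_continuous.
apply: divisible_semigroup_group => //.
- by have : [set: G] 1 by []; rewrite -PS => -[x Px _]; exists x.
- move=> x y Px Py.
  have covx : covering ((fun y => x * y) @` P).
    apply: (translate_covering covP (cR x)) => [y' z Py' Pz|g].
      by exists (y' * (x * z)); [auto|rewrite !mulgA].
    by exists ((pi x)^-1 * g) => z zh; rewrite piM zh mulVKg.
  by apply: Pmin covx _ _ Py => _ [z Pz <-]; exact: PM.
- move=> x y Px Py.
  have covx : covering ((fun y => y * x) @` P).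
    apply: (translate_covering covP (cL x)) => [y' z Py' Pz|g].
      by exists (y' * x * z); [auto|rewrite !mulgA].
    by exists (g * (pi x)^-1) => z zh; rewrite piM zh mulgVK.
  by apply: Pmin covx _ _ Py => _ [z Pz <-]; exact: PM.
Qed.

End Cover.

(** * Projective groups embed *)

Section Rigidity.
Variables (F : topologicalMonoidType) (G : topologicalGroupType).
Hypotheses (profF : profinite_monoid F) (hausG : hausdorff_space G).
Hypothesis projG : projective_group G.
Variable pi : F -> G.
Hypotheses (pic : continuous pi) (piM : {morph pi : x y / x * y}).
Variable P : set F.
Hypotheses (covP : covering pi P).
Hypothesis Pmin : forall Q, covering pi Q -> Q `<=` P -> P `<=` Q.
Variables (H : groupType) (j : H -> F).
Hypotheses (jM : {morph j : x y / x * y}) (jP : range j = P).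
Variables (S : monoidType) (s : F -> S).
Hypotheses (finS : finite_set [set: S]) (sM : {morph s : x y / x * y}).
Hypothesis sc : continuous (s : F -> discrete_topology S).

Let Pj h : P (j h). Proof. by rewrite -jP; exists h. Qed.

Let pijM : {morph (pi \o j) : x y / x * y}.
Proof. by move=> x y; rewrite /= jM piM. Qed.

Let sjM : {morph (s \o j) : x y / x * y}.
Proof. by move=> x y; rewrite /= jM sM. Qed.

Let pij_surj g : exists h, pi (j h) = g.
Proof.
have [_ _ PS] := covP; have : [set: G] g by [].
by rewrite -PS -jP => -[_ [h _ <-] <-]; exists h.
Qed.

(** The composite of the kernels of [pi \o j] and [s \o j]. It is symmetric and
    transitive because congruences on a group permute, by way of the Mal'cev
    term x y^-1 z. *)
Definition kernel_join (x y : H) : Prop :=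
  exists n, pi (j n) = pi (j x) /\ s (j n) = s (j y).

Lemma kernel_join_congruence : is_congruence kernel_join.
Proof.
have mal (T : monoidType) (f : H -> T) x y z : {morph f : x y / x * y} ->
    f x = f y -> f (x * y^-1 * z) = f z /\ f (z * y^-1 * x) = f z.
  move=> fM xy; rewrite !fM xy -!fM mulgV mul1g mulgVK.
  by [].
split.
- by move=> x; exists x.
- move=> x y [n [nx ny]]; exists (x * n^-1 * y); split.
    exact: (mal _ _ x n y pijM (esym nx)).1.
  exact: (mal _ _ y n x sjM (esym ny)).2.
- move=> x y z [n [nx ny]] [m [my mz]]; exists (n * y^-1 * m); split.
    rewrite -nx; exact: (mal _ _ m y n pijM my).2.
  rewrite -mz; exact: (mal _ _ n y m sjM ny).1.
- move=> x y z t [n [nx ny]] [m [mz mt]]; exists (n * m).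
  by rewrite !jM !piM !sM nx ny mz mt.
Qed.

(** This says at once that [s] factors through [pi] on [P] and that the
    resulting map on [G] is locally constant. *)
Lemma finite_coordinate_rigid (h : H) :
  nbhs (pi (j h)) [set g | forall h', pi (j h') = g -> s (j h') = s (j h)].
Proof.
have [clP PM PS] := covP.
pose kerC : congruence H := exist _ _ (kernel_is_congruence sjM).
pose joinC : congruence H := exist _ _ kernel_join_congruence.
have [|A [qA [qAM qAS qAE]]] := @finite_group_quotient H kerC.
  by exists (finite_carrier finS), (s \o j).
have qAs x y : s (j x) = s (j y) -> qA x = qA y by move=> xy; apply/qAE.
have [|B [qB [qBM qBS qBE]]] := @finite_group_quotient H joinC.
  by exists (finite_carrier finS), (s \o j) => x y xy; exists x.
have [alpha alphaE] : exists alpha : A -> B, forall x, alpha (qA x) = qB x.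
  have [r rK] := choice qAS; exists (qB \o r) => x; apply/qBE.
  by exists (r (qA x)); split=> //; apply/qAE.
have [phi phiE] : exists phi : G -> B, forall x, phi (pi (j x)) = qB x.
  have [r rK] := choice pij_surj; exists (qB \o r) => x; apply/qBE.
  by exists x; rewrite rK.
have alphaM : {morph alpha : x y / x * y}.
  move=> a b; have [[x <-] [y <-]] := (qAS a, qAS b).
  by rewrite -qAM !alphaE qBM.
have phiM : {morph phi : x y / x * y}.
  move=> a b; have [[x <-] [y <-]] := (pij_surj a, pij_surj b).
  by rewrite -pijM !phiE qBM.
have alphaS b : exists a, alpha a = b.
  by have [x <-] := qBS b; exists (qA x).
have phiS b : exists a, phi a = b.
  by have [x <-] := qBS b; exists (pi (j x)).
(* The points of G where phi differs from phi g are the image of a compact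
   subset of P, on which the condition is seen in S. *)
have phic : continuous (phi : G -> discrete_topology B).
  apply/continuous_discreteP => g.
  pose bad : set F := P `&` [set x | forall x', s (j x') = s x -> qB x' <> phi g].
  have badc : closed bad.
    apply: closedI => // x clx /= x' x'x.
    have [y [/= ybad yx]] := clx _ (iffLR (continuous_discreteP _) sc x).
    by apply: ybad; rewrite yx.
  have : closed (pi @` bad).
    apply: compact_closed hausG _.
    apply: continuous_compact (closed_compact profF badc).
    exact: continuous_subspaceT.
  move=> /closed_openC opC.
  have : nbhs g (~` (pi @` bad)).
    apply: open_nbhs_nbhs; split=> // -[x []].
    rewrite -{1}jP => -[y _ <-] /(_ y erefl) yb yg.
    by apply: yb; rewrite -yg phiE.
  apply: filterS => g' ng'; apply: contrapT => ne; apply: ng'.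
  have [y yg'] := pij_surj g'; exists (j y) => //; split=> // x' /= x'y.
  rewrite (_ : qB x' = phi g') // -yg' phiE; apply/qBE.
  by exists x'.
have [lam [lamM lamc lamE]] := projG alphaM alphaS phiM phiS phic.
(* The elements of P at which lam agrees with qA form a covering subsemigroup,
   which is P by minimality. *)
pose Q : set F := [set x | exists2 y, x = j y & lam (pi x) = qA y].
have QP : Q `<=` P by move=> _ [y -> _].
have lampi : continuous (lam \o pi : F -> discrete_topology A).
  by move=> x U /lamc /pic.
have covQ : covering pi Q.
  split.
  - move=> x clx; have : P x by apply: clP; exact: closureS QP _ clx.
    rewrite -{1}jP => -[y _ yx]; exists y => //.
    have [_ [[z -> zA] [/= sz lz]]] := clx _ (filterI
      (iffLR (continuous_discreteP _) sc x)
      (iffLR (continuous_discreteP _) lampi x)).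
    by rewrite -lz zA; apply: qAs; rewrite sz yx.
  - move=> _ _ [y -> yA] [z -> zA]; exists (y * z); first by rewrite jM.
    by rewrite piM lamM yA zA qAM.
  apply/seteqP; split=> // g _.
  have [x xA] := qAS (lam g); have [y yg] := pij_surj g.
  have : qB y = qB x by rewrite -phiE yg -lamE -xA alphaE.
  move=> /qBE[n [ny nx]]; exists (j n); last by rewrite ny yg.
  by exists n => //; rewrite ny yg -xA; apply: qAs; rewrite nx.
have lamqA x : lam (pi (j x)) = qA x.
  by have [y jxy ->] := Pmin covQ QP (Pj x); apply: qAs; rewrite jxy.
apply: filterS (iffLR (continuous_discreteP _) lamc (pi (j h))) => g lg h' h'g.
by apply/qAE; rewrite -!lamqA h'g.
Qed.

End Rigidity.

Lemma projective_subgroup (F : topologicalMonoidType) (G : topologicalGroupType)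
    (pi : F -> G) :
  profinite_monoid F -> hausdorff_space G -> projective_group G ->
  continuous pi -> {morph pi : x y / x * y} -> (forall g, exists x, pi x = g) ->
  exists P : set F, closed_subgroup P /\ isomorphic_to_subgroup G P.
Proof.
move=> profF hausG projG pic piM piS.
have [P [covP Pmin]] := minimal_covering profF hausG pic piS.
have [H [j [_ jM jP]]] := minimal_covering_group profF piM covP Pmin.
have [clP PM PS] := covP.
have Pj h : P (j h) by rewrite -jP; exists h.
have [_ [I [S [p [finS pM pc psep pnbhs]]]]] := profinite_coordinates profF.
have rigid i h :
    nbhs (pi (j h)) [set g | forall h', pi (j h') = g -> p i (j h') = p i (j h)].
  exact: (finite_coordinate_rigid profF hausG projG pic piM covP Pmin jM jP
    (finS i) (pM i).2 (pc i)).
have pij_inj x y : pi (j x) = pi (j y) -> j x = j y.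
  by move=> xy; apply: psep => i; exact: nbhs_singleton (rigid i y) _ xy.
have surj g : exists h, pi (j h) = g.
  have : [set: G] g by [].
  by rewrite -PS -jP => -[_ [h _ <-] <-]; exists h.
have [r rK] := choice surj.
exists P; split.
  split=> //; exists (j 1); split=> // [x|x].
    by rewrite -{1}jP => -[h _ <-]; rewrite -!jM mul1g mulg1.
  rewrite -{1}jP => -[h _ <-]; exists (j h^-1).
  by rewrite -!jM mulgV mulVg.
pose f g : P := SigSub (mem_set (Pj (r g))).
have fE g : set_val (f g) = j (r g) by [].
exists f; split; last first.
  by move=> x y; rewrite !fE -jM; apply: pij_inj; rewrite jM piM !rK.
split.
  move=> g U [_ [[W oW <-] Wg WU]].
  have [i iW] := pnbhs _ _ (open_nbhs_nbhs (conj oW Wg)).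
  have := rigid i (r g); rewrite rK => rig.
  apply: filterS rig => g' /(_ (r g') (rK g')) /iW Wg'.
  exact: WU.
exists (fun x => pi (set_val x)); split.
- move=> x; apply: (@continuous_comp _ _ _ (set_val : P -> F) pi).
    exact: initial_continuous.
  exact: pic.
- by move=> g; rewrite fE rK.
move=> x; apply: val_inj; have : P (set_val x) by exact: set_mem (valP x).
rewrite -{1}jP => -[h _ hx]; rewrite -[LHS]/(j (r (pi (set_val x)))).
by rewrite -[RHS]/(set_val x) -hx; apply: pij_inj; rewrite rK.
Qed.

(** * Projectivity and embeddability are equivalent *)

Theorem mainTheorem4 (G : topologicalGroupType) (hG : profinite_group G) :
  projective_group G <->
  exists (X : topologicalType) (F : topologicalMonoidType) (iota : X -> F)
         (H : set F),
    [/\ is_free_profinite_monoid iota,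
        closed_subgroup H &
        isomorphic_to_subgroup G H].
Proof.
split=> [projG|[X [F [iota [H [freeF _ [f [[fc [f' [f'c fK _]]] fM]]]]]]]].
  have freeF := free_profinite_is_free G; have [profF _ univF] := freeF.
  have profG := profinite_group_monoid hG.
  have [pi [[pic piM piL] _]] := univF G (fun x => x) profG (fun x => cvg_id).
  have [|P [subP isoP]] := projective_subgroup profF (profinite_hausdorff profG)
    projG pic piM.2; first by move=> g; exists (letter g).
  by exists G, (free_profinite G), (@letter G), P.
apply: (free_monoid_subgroup_projective (inc := fun g => set_val (f g)) freeF).
- exact: fM.
- move=> g; apply: (@continuous_comp _ _ _ f (set_val : H -> F)).
    exact: fc.
  exact: initial_continuous.
move=> U U1; have : nbhs (f 1) (f' @^-1` U) by apply: f'c; rewrite fK.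
move=> [_ [[W oW <-] W1 WU]]; exists W; first exact: open_nbhs_nbhs.
by move=> g Wg; have := WU (f g) Wg; rewrite /preimage /= fK.
Qed.
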